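(* Let $a=(a_i)_{i\in\mathbb Z}$ be a sequence in $\Bbbk$. For every $n\ge1$, $$\Psi_{n;a}=\sum_{k=0}^{n-1}(-1)^k R_{(1^k,n-k);a}^{[n-k-1]},\qquad \Psi_{n;a}=\sum_{k=1}^n(-1)^{k-1}k\,\Lambda_{k;a}^{[n-k]}S_{n-k;a}^{[n-k-1]},$$ where $(1^k,n-k)$ denotes the composition $(1,\ldots,1,n-k)$ with $k$ ones.
   Context: $\Bbbk$ is a field of characteristic zero and $a=(a_i)_{i\in\mathbb Z}$ is a sequence in $\Bbbk$. Put $(t\downarrow a)^k=(t-a_1)\cdots(t-a_k)$, $(t\downarrow a)^0=1$, $(\tau^s a)_i=a_{i+s}$ for $s\in\mathbb Z$, and $\hat a_i=-a_{-i+1}$. $\mathrm{Sym}^a=\Bbbk\langle S_{1;a},S_{2;a},\ldots\rangle$ is the free associative unital $\Bbbk$-algebra on $S_{k;a}$, $k\ge1$. With $t$ a central variable and all expressions expanded as formal power series in $1/t$, put $\sigma^a(t)=\sum_{k\ge0}S_{k;a}/(t\downarrow a)^k$ and $\lambda^{\hat a}(t)=\sum_{k\ge0}\Lambda_{k;a}/(t\downarrow\hat a)^k$ with $S_{0;a}=\Lambda_{0;a}=1$; the elements $\Lambda_{k;a}\in\mathrm{Sym}^a$ are determined by $\lambda^{\hat a}(-t)\sigma^a(t)=\sigma^a(t)\lambda^{\hat a}(-t)=1$. Shifts: for $s\in\mathbb Z$, $S_{k;a}^{[s]}$ and $\Lambda_{k;a}^{[s]}$ are defined by $\sum_{k\ge0}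 S_{k;a}^{[s]}/(t\downarrow\tau^{-s}a)^k=\sum_{k\ge0}S_{k;a}/(t\downarrow a)^k$ and $\sum_{k\ge0}\Lambda_{k;a}^{[s]}/(t\downarrow\tau^{s}\hat a)^k=\sum_{k\ge0}\Lambda_{k;a}/(t\downarrow\hat a)^k$. The $a$-shifted power sums are $\Psi_{n;a}=\sum_{k=0}^{n-1}(-1)^k(n-k)\Lambda_{k;a}^{[n-k]}S_{n-k;a}^{[n-k-1]}$. Quasideterminants: for an $n\times n$ matrix $A$ over a unital ring such that the matrix $A^{pq}$ (delete row $p$ and column $q$) is invertible, $|A|_{pq}=a_{pq}-r(A^{pq})^{-1}c$, where $r$ is the $p$-th row of $A$ with $a_{pq}$ removed and $c$ is the $q$-th column of $A$ with $a_{pq}$ removed. For a composition $I=(i_1,\ldots,i_n)$ (positive integers) and $K\in\mathbb Z^n$ set $R_{I;a}^{[K]}=(-1)^{n-1}|M|_{1n}$, where $M_{pq}=S_{i_p+\cdots+i_q;a}^{[k_p]}$ if $p\le q$, $M_{q+1,q}=1$, $M_{pq}=0$ if $p>q+1$. With $s_k=\sum_{\nu=k}^{n-1}i_\nu$, for $s\in\mathbb Z$ put $R_{I;a}^{[s]}=R_{I;a}^{[(s_1+s,\ldots,s_{n-1}+s,s)]}$. *)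

(* Defs.v *)
(* MathComp library, with the free monoid algebras of multinomials. *)
From Stdlib Require Import ClassicalEpsilon.
From mathcomp Require Import all_boot all_order all_algebra.
From mathcomp Require Import monalg.

Set Implicit Arguments.
Unset Strict Implicit.
Unset Printing Implicit Defensive.

Import GRing.Theory.
Local Open Scope ring_scope.

(* A formal power series in 1/t over A is a function f : nat -> A, with f n   *)
(* the coefficient of t^(-n); equality of series is pointwise (=1).           *)
Section Series.
Variable A : nzRingType.
Implicit Types f g h : nat -> A.

Definition fps_one : nat -> A := fun n => (n == 0%N)%:R.

(* t is central, so this is the usual Cauchy product.                         *)
Definition fps_mul f g : nat -> A := fun n => \sum_(i < n.+1) f i * g (n - i)%N.

(* The substitution of -t for t.                                              *)
Definition fps_neg f : nat -> A := fun n => (-1) ^+ n * f n.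

End Series.
Arguments fps_one {A}.

Section Expansions.
Variable K : fieldType.
Implicit Types (a b : int -> K) (s : int).

Definition tau s a : int -> K := fun i => a (i + s).

Definition hat a : int -> K := fun i => - a (- i + 1).

(* 1/(t - c) = sum_(m >= 0) c^m / t^(m+1).                                    *)
Definition inv_linear (c : K) : nat -> K :=
  fun n => if n is m.+1 then c ^+ m else 0.

(* 1/((t - b_1) ... (t - b_k)).                                               *)
Fixpoint inv_down b (k : nat) : nat -> K :=
  if k is j.+1 then fps_mul (inv_down b j) (inv_linear (b k%:Z)) else fps_one.

(* sum_(k >= 0) c_k / (t|b)^k: by inv_down_lt below, the terms with k > n     *)
(* do not contribute to the coefficient of t^(-n).                            *)
Definition dseries (A : lmodType K) b (c : nat -> A) : nat -> A :=
  fun n => \sum_(k < n.+1) inv_down b k n *: c k.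

(* The family c with sum_(k >= 0) c_k / (t|b)^k = f; it exists and is unique, *)
(* see dcoefP and dcoef_uniq.                                                 *)
Definition dcoef (A : lmodType K) b (f : nat -> A) : nat -> A :=
  epsilon (inhabits (fun=> 0)) (fun c => dseries b c =1 f).

End Expansions.

Section Quasideterminant.
Variable A : nzRingType.

Definition is_mxinv m (B C : 'M[A]_m) := C *m B = 1%:M /\ B *m C = 1%:M.

(* The two-sided inverse over a possibly noncommutative ring; junk if there   *)
(* is none.                                                                   *)
Definition ncinvmx m (B : 'M[A]_m) : 'M[A]_m :=
  epsilon (inhabits 0) (is_mxinv B).

Definition quasidet m (M : 'M[A]_m.+1) (p q : 'I_m.+1) : A :=
  M p q
  - (row p (col' q M) *m ncinvmx (row' p (col' q M)) *m col q (row' p M)) 0 0.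

End Quasideterminant.

(* The letter j of the free monoid on nat stands for the generator S_(j+1).   *)
Notation Sym K := {malg K[{fmonom nat}]}.

Section Sym.
Variables (K : fieldType) (a : int -> K).
Implicit Types (k n m : nat) (s : int).

Definition Sgen k : Sym K := if k is j.+1 then << fmu j >> else 1.

Definition sigma : nat -> Sym K := dseries a Sgen.

(* Lam is the family Lambda_k, i.e. lambda^(hat a)(t) := dseries (hat a) Lam. *)
Definition is_Lambda (Lam : nat -> Sym K) :=
  [/\ Lam 0%N = 1,
      fps_mul (fps_neg (dseries (hat a) Lam)) sigma =1 fps_one
    & fps_mul sigma (fps_neg (dseries (hat a) Lam)) =1 fps_one].

(* See LambdaP and Lambda_uniq for existence and uniqueness.                  *)
Definition Lambda : nat -> Sym K := epsilon (inhabits (fun=> 0)) is_Lambda.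

Definition lambda : nat -> Sym K := dseries (hat a) Lambda.

(* S_k^[s] and Lambda_k^[s].                                                  *)
Definition Ssh s : nat -> Sym K := dcoef (tau (- s) a) sigma.

Definition Lambdash s : nat -> Sym K := dcoef (tau s (hat a)) lambda.

Definition Psi n : Sym K :=
  \sum_(k < n) (-1) ^+ k * (n - k)%:R *
    (Lambdash (n%:Z - k%:Z) k * Ssh (n%:Z - k%:Z - 1) (n - k)).

(* Rows, columns and parts are numbered from 0 to m, the composition I having *)
(* n = m + 1 parts.                                                           *)
Definition ribbon_mx m (I : m.+1.-tuple nat) (k : 'I_m.+1 -> int) :
    'M[Sym K]_m.+1 :=
  \matrix_(p, q)
    if (p <= q)%N then Ssh (k p) (\sum_(nu < m.+1 | p <= nu <= q) tnth I nu)%N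
    else if p == q.+1 :> nat then 1
    else 0.

Definition ribbonK m (I : m.+1.-tuple nat) (k : 'I_m.+1 -> int) : Sym K :=
  (-1) ^+ m * quasidet (ribbon_mx I k) ord0 ord_max.

Definition ribbon_shift m (I : m.+1.-tuple nat) (p : 'I_m.+1) : nat :=
  (\sum_(nu < m.+1 | p <= nu < m) tnth I nu)%N.

(* R_I^[s], for a single s; the last shift is s since ribbon_shift vanishes   *)
(* at p = m.                                                                  *)
Definition ribbon m (I : m.+1.-tuple nat) s : Sym K :=
  ribbonK I (fun p => (ribbon_shift I p)%:Z + s).

End Sym.

(* The composition (1^k, l), with k ones.                                     *)
Definition hook (k l : nat) : k.+1.-tuple nat :=
  rcons_tuple (nseq_tuple k 1%N) l.

Section SeriesTheory.
Variable A : nzRingType.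
Implicit Types f g h : nat -> A.

Lemma fps_mul_poly N f g n : (n < N)%N ->
  fps_mul f g n = ((\poly_(i < N) f i) * (\poly_(i < N) g i))`_n.
Proof.
move=> nN; rewrite coefM; apply: eq_bigr => i _; rewrite !coef_poly.
rewrite (leq_ltn_trans _ nN) ?(leq_ltn_trans (leq_subr _ _) nN) //.
by rewrite -ltnS.
Qed.

Lemma eq_fps_mul f f' g g' : f =1 f' -> g =1 g' ->
  fps_mul f g =1 fps_mul f' g'.
Proof. by move=> ef eg n; apply: eq_bigr => i _; rewrite ef eg. Qed.

Lemma fps_mulA f g h : fps_mul f (fps_mul g h) =1 fps_mul (fps_mul f g) h.
Proof.
move=> n; pose P f := \poly_(i < n.+1) f i.
have tr u v : forall i, (i <= n)%N -> (P (fps_mul u v))`_i = (P u * P v)`_i.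
  by move=> i le_in; rewrite coef_poly ltnS le_in -fps_mul_poly.
rewrite !(@fps_mul_poly n.+1) // -!/(P _).
transitivity ((P f * (P g * P h))`_n).
  by rewrite !coefM; apply: eq_bigr => i _; rewrite tr // leq_subr.
rewrite mulrA !coefM; apply: eq_bigr => i _; rewrite tr //.
by rewrite -ltnS.
Qed.

Lemma fps_mul1f f : fps_mul fps_one f =1 f.
Proof.
move=> n; rewrite /fps_mul big_ord_recl /= /fps_one eqxx mul1r subn0.
by rewrite big1 ?addr0 // => i _; rewrite mul0r.
Qed.

Lemma fps_mulf1 f : fps_mul f fps_one =1 f.
Proof.
move=> n; rewrite /fps_mul big_ord_recr /= /fps_one subnn eqxx mulr1.
rewrite big1 ?add0r // => i _.
by rewrite subn_eq0 leqNgt ltn_ord mulr0.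
Qed.

Lemma fps_negK f : fps_neg (fps_neg f) =1 f.
Proof. by move=> n; rewrite /fps_neg mulrA -expr2 sqrr_sign mul1r. Qed.

Lemma fps_neg_inj f g : fps_neg f =1 fps_neg g -> f =1 g.
Proof. by move=> fg n; rewrite -(fps_negK f) -(fps_negK g) {1}/fps_neg fg. Qed.

Lemma course_of_values (F : (nat -> A) -> nat -> A) :
    (forall f g n, (forall i, (i < n)%N -> f i = g i) -> F f n = F g n) ->
  exists f, forall n, f n = F f n.
Proof.
move=> Floc.
pose pre := fix pre n := if n is m.+1 then rcons (pre m) (F (nth 0 (pre m)) m)
                         else [::].
have szp n : size (pre n) = n by elim: n => //= n IH; rewrite size_rcons IH.
have prep m n i : (i < m)%N -> (m <= n)%N -> nth 0 (pre n) i = nth 0 (pre m) i.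
  move=> im; elim: n => [|n IH]; first by rewrite leqn0 => /eqP m0; rewrite m0 in im.
  rewrite leq_eqVlt ltnS => /predU1P[->//|mn] /=.
  by rewrite nth_rcons szp (leq_trans im mn) IH.
exists (fun n => nth 0 (pre n.+1) n) => n.
rewrite /= nth_rcons szp ltnn eqxx; apply: Floc => i lt_in.
by rewrite -(@prep i.+1 n i).
Qed.

Lemma fps_inv_uniq f g h :
  fps_mul g f =1 fps_one -> fps_mul f h =1 fps_one -> g =1 h.
Proof.
move=> gf fh n; rewrite -(fps_mulf1 g) -(eq_fps_mul (frefl g) fh) fps_mulA.
by rewrite (eq_fps_mul gf (frefl h)) fps_mul1f.
Qed.

Lemma fps_left_inv f : f 0%N = 1 ->
  exists2 g, g 0%N = 1 & fps_mul g f =1 fps_one.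
Proof.
move=> f0.
pose F (g : nat -> A) n := if n is _.+1 then - \sum_(i < n) g i * f (n - i)%N else 1.
have [|g gE] := @course_of_values F.
  move=> u v [|n] //= uv; congr (- _); apply: eq_bigr => i _.
  by rewrite uv.
exists g; first by rewrite gE.
case=> [|n]; rewrite /fps_mul big_ord_recr /= subnn f0 mulr1.
  by rewrite big_ord0 add0r gE.
by rewrite [g n.+1]gE /= addrN.
Qed.

Lemma fps_inv f : f 0%N = 1 -> exists g,
  [/\ g 0%N = 1, fps_mul g f =1 fps_one & fps_mul f g =1 fps_one].
Proof.
move=> f0; have [g g0 gf] := fps_left_inv f0.
have [h _ hg] := fps_left_inv g0.
exists g; split=> // n; rewrite -[RHS]hg; apply: eq_fps_mul => // i.
by rewrite -(fps_inv_uniq hg gf).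
Qed.

End SeriesTheory.

Section ExpansionsTheory.
Variables (K : fieldType) (A : lmodType K).
Implicit Types (b : int -> K) (c f : nat -> A).

Lemma inv_downS b k :
  inv_down b k.+1 = fps_mul (inv_down b k) (inv_linear (b k.+1%:Z)).
Proof. by []. Qed.

Lemma inv_down_lt b k n : (n < k)%N -> inv_down b k n = 0.
Proof.
elim: k n => // k IH n; rewrite ltnS inv_downS => nk; rewrite [LHS]big1 // => i _.
have := ltn_ord i; rewrite ltnS leq_eqVlt => /predU1P[->|lt_in].
  by rewrite subnn mulr0.
by rewrite IH ?mul0r // (leq_trans lt_in).
Qed.

Lemma inv_down_diag b k : inv_down b k k = 1.
Proof.
elim: k => // k IH; rewrite inv_downS [LHS]big_ord_recr /= subnn mulr0 addr0.
rewrite big_ord_recr /= IH subSnn mulr1 big1 ?add0r // => i _.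
by rewrite inv_down_lt ?mul0r.
Qed.

Lemma dseriesE b c n :
  dseries b c n = \sum_(k < n) inv_down b k n *: c k + c n.
Proof. by rewrite /dseries big_ord_recr /= inv_down_diag scale1r. Qed.

Lemma dseries_inj b c c' : dseries b c =1 dseries b c' -> c =1 c'.
Proof.
move=> eq_cc' n; elim/ltn_ind: n => n IH; have := eq_cc' n; rewrite !dseriesE.
rewrite (eq_bigr (fun k : 'I_n => inv_down b k n *: c' k)) => [/addrI//|k _].
by rewrite IH.
Qed.

Lemma dcoef_uniq b f c : dseries b c =1 f -> dcoef b f =1 c.
Proof.
move=> cf; apply: (@dseries_inj b) => n; rewrite cf; move: n.
exact: (epsilon_spec (inhabits (fun=> 0)) _
  (ex_intro (fun c => dseries b c =1 f) c cf)).
Qed.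

End ExpansionsTheory.

Section QuasideterminantTheory.
Variable A : nzRingType.

Lemma ncinvmx_uniq m (B C : 'M[A]_m) : is_mxinv B C -> ncinvmx B = C.
Proof.
move=> BC; have [CB1 BC1] := BC.
have [DB1 _] := epsilon_spec (inhabits 0) _ (ex_intro (is_mxinv B) C BC).
by rewrite -[LHS]mulmx1 -BC1 mulmxA [_ *m B]DB1 mul1mx.
Qed.

End QuasideterminantTheory.

Section SymTheory.
Variables (K : fieldType) (a : int -> K).

Lemma dcoefP b (f : nat -> Sym K) : dseries b (dcoef b f) =1 f.
Proof.
have [|c cE] := @course_of_values (Sym K)
    (fun c n => f n - \sum_(k < n) inv_down b k n *: c k).
  by move=> u v n uv; congr (_ - _); apply: eq_bigr => i _; rewrite uv.
have cf : dseries b c =1 f by move=> n; rewrite dseriesE cE addrC subrK.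
exact: (epsilon_spec (inhabits (fun=> 0)) _
  (ex_intro (fun c => dseries b c =1 f) c cf)).
Qed.

Lemma LambdaP : is_Lambda a (Lambda a).
Proof.
apply: (epsilon_spec (inhabits (fun=> 0)) (is_Lambda a)).
have [|g [g0 gs sg]] := @fps_inv _ (sigma a).
  by rewrite /sigma dseriesE big_ord0 add0r.
pose L := dcoef (hat a) (fps_neg g).
have LE : fps_neg (dseries (hat a) L) =1 g.
  by move=> n; rewrite -[RHS]fps_negK /fps_neg dcoefP.
exists L; split.
- have := dcoefP (hat a) (fps_neg g) 0%N.
  by rewrite dseriesE big_ord0 add0r -/L => ->; rewrite /fps_neg g0 mulr1.
- by move=> n; rewrite (eq_fps_mul LE (frefl _)).
- by move=> n; rewrite (eq_fps_mul (frefl _) LE).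
Qed.

Lemma Lambda_uniq (L : nat -> Sym K) : is_Lambda a L -> Lambda a =1 L.
Proof.
case=> _ _ sL; have [_ Ls _] := LambdaP.
apply: (@dseries_inj _ _ (hat a)); apply: fps_neg_inj.
exact: fps_inv_uniq Ls sL.
Qed.

End SymTheory.

(* Main.v *)
Require Import Defs.
From mathcomp Require Import all_boot all_order all_algebra.
From mathcomp Require Import finmap monalg zify.

Set Implicit Arguments.
Unset Strict Implicit.
Unset Printing Implicit Defensive.

Import GRing.Theory.
Local Open Scope ring_scope.

(** Let <f> denote the multiplication by a series f in 1/t, expanded in the
basis 1/((t - b_1) ... (t - b_p)), p >= 0, of the series in 1/t. In that basis
<f> has an upper triangular matrix: its entry at (p, q), p < q, is the
coefficient of 1/t in f(t) (t - b_{p+1}) ... (t - b_{q-1}), and its diagonal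
entries are f(infinity). Multiplication of series becomes multiplication of
matrices ([mulmat_mul]), even when the coefficients do not commute.

Fix n and take b_i = a_{i+1-n}. Reading off a coefficient of an expansion in
shifted powers as a residue ([dseries_residue]) shows that the shifts in the
theorem are exactly those for which S_{q-p}^{[n-p-1]} is the (p, q) entry of
the matrix U of sigma^a(t), and (-1)^{q-p} Lambda_{q-p}^{[n-q]} is the (p, q)
entry of the matrix V of lambda^{hat a}(-t) ([Ssh_mulmat], [Lambdash_mulmat]).
Since the two series are inverse to each other, U V = V U = 1. Put
  T_k = V_{0k} U_{kn} = (-1)^k Lambda_k^{[n-k]} S_{n-k}^{[n-k-1]},
so that Psi_n is the sum of the (n - k) T_k.

The second formula for Psi_n says that the sum of the n T_k vanishes, and this
sum is n times the (0, n) entry of V U. For the first formula, the ribbon of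
the hook (1^k, n - k) is built on the matrix formed by the rows 0, ..., k and
the columns 1, ..., k, n of U. The submatrix inverted by its quasideterminant
is the block 1, ..., k of U, whose inverse is the same block of V, and the
quasideterminant equals T_0 + ... + T_k ([quasidet_hessenberg],
[ribbon_hook]). Summing over k < n counts T_q exactly n - q times. *)

(** * Residues of products of a series with linear factors *)

Section ScalarsCentral.
Variables (M : monomType) (R : comNzRingType).

(** A left algebra structure says nothing on scalars in the right factor of a
product; their centrality is a hypothesis of the theory of residues, which this
lemma provides for the noncommutative monoid algebra. *)
Lemma malg_scaleAr (c : R) (g1 g2 : {malg R[M]}) :
  c *: (g1 * g2) = g1 * (c *: g2).
Proof.
apply/malgP => k; rewrite mcoeffZ (mcoeffMlw _ (fsubset_refl _) (msuppZ_le c g2)).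
rewrite mcoeffMl mulr_sumr; apply: eq_bigr => k1 _.
rewrite mulr_sumr; apply: eq_bigr => k2 _.
by rewrite mcoeffZ mulrCA mulrnAr.
Qed.

End ScalarsCentral.

Section Residue.
Variables (K : fieldType) (A : lalgType K).
Hypothesis scaleAr : forall (c : K) (x y : A), c *: (x * y) = x * (c *: y).
Implicit Types (f g : nat -> A) (c : K) (s : seq K).

(** The product (t - c) f(t) without its polynomial term f_0 t: a multiple of t
by a polynomial never contributes to the coefficient of 1/t, so that
discarding it is harmless for residues and keeps the result a series in 1/t. *)
Definition mul_linear c f : nat -> A := fun n => f n.+1 - c *: f n.

(** The coefficient of 1/t in (t - c_1) ... (t - c_k) f(t), for s = c_1 ... c_k. *)
Fixpoint residue f s : A :=
  if s is c :: s' then residue (mul_linear c f) s' else f 1%N.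

Lemma eq_residue f g : f =1 g -> residue f =1 residue g.
Proof.
move=> fg s; elim: s f g fg => [|c s IHs] f g fg /=; first exact: fg.
by apply: IHs => n; rewrite /mul_linear !fg.
Qed.

Lemma residueD f g s :
  residue (fun n => f n + g n) s = residue f s + residue g s.
Proof.
elim: s f g => //= c s IHs f g; rewrite -IHs; apply: eq_residue => n.
by rewrite /mul_linear scalerDr opprD addrACA.
Qed.

Lemma residueMl x f s : residue (fun n => x * f n) s = x * residue f s.
Proof.
elim: s f => //= c s IHs f; rewrite -IHs; apply: eq_residue => n.
by rewrite /mul_linear mulrBr scaleAr.
Qed.

Lemma residue_eq0 f s : (forall n, f n.+1 = 0) -> residue f s = 0.
Proof.
elim: s f => [|c s IHs] f f0 /=; first exact: f0.
by apply: IHs => n; rewrite /mul_linear !f0 scaler0 subr0.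
Qed.

Lemma residue_rcons f s c : residue f (rcons s c) = residue f (c :: s).
Proof.
elim: s f => //= d s IHs f; rewrite IHs /=; apply: eq_residue => n.
rewrite /mul_linear !scalerBr !scalerA (mulrC d c) !opprB ![_ + (_ *: _ - _)]addrA.
by rewrite [LHS]addrAC [RHS]addrAC [in RHS](addrAC _ (- _) (- _)).
Qed.

(** The factors commute. The two families of shifted powers list the nodes in
opposite orders, and this makes them comparable. *)
Lemma residue_rev f s : residue f (rev s) = residue f s.
Proof.
by elim: s f => //= c s IHs f; rewrite rev_cons residue_rcons /= IHs.
Qed.

Lemma residue_neg f s :
  residue (fps_neg f) s = (-1) ^+ (size s).+1 * residue f (map -%R s).
Proof.
elim: s f => //= c s IHs f; rewrite exprS mulN1r mulNr -mulrN.
rewrite -[- residue _ _]mulN1r -residueMl.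
transitivity (residue (fps_neg (fun n => -1 * mul_linear (- c) f n)) s).
  apply: eq_residue => n; rewrite /mul_linear /fps_neg.
  rewrite exprS mulN1r !mulNr mul1r mulrN scaleNr opprK mulrDr opprD.
  by rewrite scaleAr.
exact: IHs.
Qed.

Lemma mul_linear_fps_mul c f g n :
  mul_linear c (fps_mul f g) n =
    f 0%N * g n.+1 + fps_mul (mul_linear c f) g n.
Proof.
rewrite /mul_linear /fps_mul big_ord_recl /= subn0 -addrA; congr (_ + _).
rewrite scaler_sumr -sumrB; apply: eq_bigr => i _.
by rewrite mulrBl scalerAl.
Qed.

(** The residue at P = (t - c_1) ... (t - c_k) of a product f g depends on the
constant terms and, through the divided difference (P(x) - P(y)) / (x - y), on
the residues of f and g: this divided difference is the sum over i of
  (x - c_1) ... (x - c_{i-1}) (y - c_{i+1}) ... (y - c_k).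
The induction peels off c_1, which acts on f alone up to the term f_0 t. *)
Lemma residue_mul f g s :
  residue (fps_mul f g) s =
    f 0%N * residue g s
    + \sum_(i < size s) residue f (take i s) * residue g (drop i.+1 s)
    + residue f s * g 0%N.
Proof.
elim: s f => [|c s IHs] f /=.
  by rewrite big_ord0 addr0 /fps_mul !big_ord_recl big_ord0 addr0.
have step n : mul_linear c (fps_mul f g) n =
    f 0%N * mul_linear c g n + ((c *: f 0%N) * g n
    + fps_mul (mul_linear c f) g n).
  rewrite mul_linear_fps_mul addrA; congr (_ + _).
  by rewrite /mul_linear mulrBr -scalerAl scaleAr subrK.
(* mul_linear c f has constant term f 1 - c f 0; its part - c f 0 cancels the
   extra summand of step, and f 1 is the term i = 0 of the sum. *)
rewrite (eq_residue step) (residueD (fun n => _ * mul_linear c g n)).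
rewrite (residueMl _ (mul_linear c g)) (residueD (fun n => _ * g n)).
rewrite (residueMl _ g) IHs.
rewrite big_ord_recl /= drop0 /mul_linear mulrBl !addrA; congr (_ + _ + _).
by rewrite -!addrA; congr (_ + _); rewrite addrCA subrr addr0.
Qed.

End Residue.

(** * Multiplication of series as a triangular matrix *)

Section MulMat.
Variables (K : fieldType) (A : lalgType K) (b : nat -> K).
Hypothesis scaleAr : forall (c : K) (x y : A), c *: (x * y) = x * (c *: y).
Implicit Types (f g : nat -> A) (p q r : nat).

(** The entry (p, q) of the matrix of g |-> f g in the basis
1/((t - b_1) ... (t - b_p)). *)
Definition mulmat f p q : A :=
  if (p < q)%N then residue f (map b (iota p.+1 (q - p.+1)))
  else if p == q then f 0%N else 0.

Lemma mulmat_lower f p q : (q < p)%N -> mulmat f p q = 0.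
Proof. by rewrite /mulmat => qp; rewrite ltnNge ltnW //= gtn_eqF. Qed.

Lemma mulmat_diag f p : mulmat f p p = f 0%N.
Proof. by rewrite /mulmat ltnn eqxx. Qed.

Lemma mulmat_one p q : mulmat fps_one p q = (p == q)%:R.
Proof.
rewrite /mulmat; case: ltngtP => //= _.
by rewrite residue_eq0.
Qed.

Lemma eq_mulmat f g : f =1 g -> mulmat f =2 mulmat g.
Proof. by move=> fg p q; rewrite /mulmat (eq_residue fg) fg. Qed.

(** Multiplying by f and then by g amounts to multiplying by f g; on the entries
above the diagonal this is [residue_mul], the terms r = p and r = q giving the
two summands with constant terms. *)
Lemma mulmat_mul f g N p q : (q < N)%N ->
  \sum_(r < N) mulmat f p r * mulmat g r q = mulmat (fps_mul f g) p q.
Proof.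
move=> qN; have [qp|pq] := ltnP q p.
  rewrite mulmat_lower // big1 // => r _.
  have [rp|pr] := ltnP r p; first by rewrite mulmat_lower // mul0r.
  by rewrite [mulmat g r q]mulmat_lower ?mulr0 // (leq_trans qp).
rewrite -(big_mkord xpredT (fun r => mulmat f p r * mulmat g r q)).
rewrite (big_cat_nat _ (n := p)) //=; last by rewrite ltnW // (leq_ltn_trans pq).
rewrite (big_cat_nat _ (n := q.+1) (m := p)) //=; last exact: leqW.
rewrite big_nat_cond big1 ?add0r; last first.
  by move=> r /andP[/andP[_ rp] _]; rewrite mulmat_lower // mul0r.
rewrite [X in _ + X]big_nat_cond [X in _ + X]big1 ?addr0; last first.
  by move=> r /andP[/andP[qr _] _]; rewrite [mulmat g r q]mulmat_lower // mulr0.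
move: pq; rewrite leq_eqVlt => /predU1P[<-|pq].
  by rewrite big_nat1 !mulmat_diag /fps_mul big_ord_recl big_ord0 addr0.
rewrite big_nat_recr ?(ltnW pq) //= big_ltn // !mulmat_diag.
rewrite /mulmat pq (residue_mul scaleAr) size_map size_iota; congr (_ + _ + _).
rewrite -{1}[p.+1]add0n big_addn big_mkord; apply: eq_bigr => i _.
have iq : (i + p.+1 < q)%N by have := ltn_ord i; lia.
rewrite ltn_addl // iq -!map_take -!map_drop take_iota drop_iota.
congr (residue _ (map b (iota _ _)) * residue _ (map b (iota _ _))); have := ltn_ord i; lia.
Qed.

End MulMat.

(** * Coefficients of expansions in shifted powers are residues *)

Section Expansion.
Variables (K : fieldType) (A : lalgType K).
Implicit Types (b : int -> K) (c : nat -> A).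

Lemma inv_linear_mul (x : K) (g : nat -> K) n :
  fps_mul (inv_linear x) g n.+1 = g n + x * fps_mul (inv_linear x) g n.
Proof.
rewrite /fps_mul big_ord_recl /= mul0r add0r big_ord_recl /= mul1r subSS subn0.
congr (_ + _); rewrite big_ord_recl /= mul0r add0r mulr_sumr.
apply: eq_bigr => i _.
by rewrite /bump /= exprS mulrA.
Qed.

(** The recursive definition of inv_down peels off the last factor, whereas
residues are computed by peeling off the first one. *)
Lemma inv_down_recl b k :
  inv_down b k.+1 =1 fps_mul (inv_linear (b 1)) (inv_down (tau 1 b) k).
Proof.
elim: k => [|k IHk] n; first by rewrite inv_downS fps_mul1f fps_mulf1.
rewrite inv_downS (eq_fps_mul IHk (frefl _)) -fps_mulA.
by rewrite inv_downS /tau -PoszD addn1.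
Qed.

Lemma inv_down_rec b k n :
  inv_down b k.+1 n.+1 = inv_down (tau 1 b) k n + b 1 * inv_down b k.+1 n.
Proof. by rewrite !inv_down_recl inv_linear_mul. Qed.

(** Multiplication by t - b_1 cancels the first factor of every denominator and
shifts the coefficients. The constant terms come from c_1 and from
(t - b_1) c_0. *)
Lemma mul_linear_dseries b c :
  mul_linear (b 1) (dseries b c) =1
    dseries (tau 1 b) (fun k => if k is 0 then c 1%N - b 1 *: c 0%N else c k.+1).
Proof.
move=> n; rewrite /mul_linear.
have -> : dseries b c n = \sum_(k < n.+2) inv_down b k n *: c k.
  by rewrite [RHS]big_ord_recr inv_down_lt // scale0r; exact: esym (addr0 _).
rewrite {1}/dseries scaler_sumr -sumrB [LHS]big_ord_recl [in LHS]big_ord_recl.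
rewrite [RHS]/dseries big_ord_recl.
rewrite addrA; congr (_ + _); last first.
  apply: eq_bigr => i _; rewrite inv_down_rec scalerA -scalerBl.
  by rewrite addrK.
rewrite inv_down_rec /= {1}/fps_one /= scale0r sub0r scalerDl !scalerA.
by rewrite addrK addrC scalerBr scalerA [_ * b 1]mulrC.
Qed.

(** Multiplied by (t - b_1) ... (t - b_k), the term c_j/(t|b)^j becomes a
polynomial for j <= k, has leading term c_{k+1}/t for j = k + 1, and is of
order at least 2 in 1/t for larger j. *)
Lemma dseries_residue b c k :
  c k.+1 = residue (dseries b c) [seq b i%:Z | i <- iota 1 k].
Proof.
elim: k b c => [|k IHk] b c /=.
  by rewrite dseriesE big_ord_recl big_ord0 /= {1}/fps_one scale0r !add0r.
rewrite (eq_residue (mul_linear_dseries b c)) -[2%N]addn1 iotaDl -map_comp.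
rewrite (eq_map (g := fun i => tau 1 b i%:Z)).
  by rewrite -IHk.
by move=> i; rewrite /tau /= PoszD addrC.
Qed.

End Expansion.

(** * A quasideterminant of Hessenberg type *)

Section Hessenberg.
Variables (A : nzRingType) (U V : nat -> nat -> A) (k : nat).
Hypothesis UV : forall p q, (p <= k)%N -> (q <= k)%N ->
  \sum_(r < k.+1) U p r * V r q = (p == q)%:R.
Hypothesis VU : forall p q, (p <= k)%N -> (q <= k)%N ->
  \sum_(r < k.+1) V p r * U r q = (p == q)%:R.
Hypothesis U0 : forall p, U p 0%N = (p == 0%N)%:R.
Hypothesis V0 : forall p, V p 0%N = (p == 0%N)%:R.

(** Index 0 of U and V interacts only with itself in the first column, hence the
blocks 1, ..., k of U and V are inverse to each other, and the first row of
U V = 1 expresses the product of the first row of U with the block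
of V as minus the first row of V. *)
Lemma quasidet_hessenberg n :
  quasidet (\matrix_(p < k.+1, q < k.+1) U p (if (q < k)%N then q.+1 else n))
      ord0 ord_max =
    \sum_(q < k.+1) V 0%N q * U q n.
Proof.
pose C : 'M[A]_k := \matrix_(i, j) V i.+1 j.+1.
set M := \matrix_(_, _) _.
have BC : is_mxinv (row' ord0 (col' ord_max M)) C.
  split; apply/matrixP => i j; rewrite !mxE.
    rewrite -[RHS]/((i.+1 == j.+1)%:R) -VU ?ltn_ord // big_ord_recl V0 mul0r add0r.
    by apply: eq_bigr => r _; rewrite !mxE lift0 lift_max ltn_ord.
  rewrite -[RHS]/((i.+1 == j.+1)%:R) -UV ?ltn_ord // big_ord_recl U0 mul0r add0r.
  by apply: eq_bigr => r _; rewrite !mxE lift0 lift_max ltn_ord.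
have rC : row ord0 (col' ord_max M) *m C = \row_j - V 0%N j.+1.
  apply/matrixP => i j; rewrite !mxE.
  have /eqP := UV (leq0n k) (ltn_ord j); rewrite big_ord_recl U0 mul1r.
  rewrite addrC addr_eq0 => /eqP <-.
  by apply: eq_bigr => r _; rewrite !mxE lift_max ltn_ord.
rewrite /quasidet (ncinvmx_uniq BC) rC !mxE ltnn big_ord_recl V0 mul1r.
rewrite -sumrN; congr (_ + _); apply: eq_bigr => r _.
by rewrite !mxE lift0 ltnn mulNr opprK.
Qed.

End Hessenberg.

(** * The elements S and Lambda as matrix entries *)

Section SymMulMat.
Variables (K : fieldType) (a : int -> K) (n : nat).

(** The node b_i = a_{i+1-n}, so that b_1, ..., b_{n-1} are a_{2-n}, ..., a_0: the
factors in the residue that computes S_n^{[n-1]}. *)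
Definition node (i : nat) : K := a (i%:Z + 1 - n%:Z).

Definition sigma_mx := mulmat node (sigma a).
Definition lambda_mx := mulmat node (fps_neg (lambda a)).

Lemma dcoef0 b (f : nat -> Sym K) : dcoef b f 0%N = f 0%N.
Proof. by rewrite -[RHS](dcoefP b) dseriesE big_ord0 add0r. Qed.

Lemma dcoef_residue b (f : nat -> Sym K) k :
  dcoef b f k.+1 = residue f [seq b i%:Z | i <- iota 1 k].
Proof. by rewrite (dseries_residue b) (eq_residue (dcoefP b f)). Qed.

Lemma sigma0 : sigma a 0%N = 1.
Proof. by rewrite /sigma dseriesE big_ord0 add0r. Qed.

Lemma lambda0 : fps_neg (lambda a) 0%N = 1.
Proof.
have [L0 _ _] := LambdaP a.
by rewrite /fps_neg /lambda dseriesE big_ord0 add0r mul1r.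
Qed.

(** S_{q-p}^{[n-p-1]} is the residue of sigma^a at the nodes a_{p+2-n}, ...,
a_{q-n}, which are b_{p+1}, ..., b_{q-1}. *)
Lemma Ssh_mulmat p q : (p <= q)%N ->
  Ssh a (n%:Z - p%:Z - 1) (q - p) = sigma_mx p q.
Proof.
rewrite leq_eqVlt /sigma_mx /Ssh => /predU1P[->|pq].
  by rewrite subnn mulmat_diag dcoef0.
rewrite /mulmat pq -subnSK // dcoef_residue; congr residue.
have -> : iota p.+1 (q - p.+1) = map (addn p) (iota 1 (q - p.+1)).
  by rewrite -iotaDl addn1.
rewrite -map_comp; apply: eq_map => i; rewrite /tau /node /=; congr a; lia.
Qed.

(** Replacing t by - t turns the nodes of hat a into those of a and accounts for
the sign. *)
Lemma Lambdash_mulmat p q : (p <= q)%N ->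
  (-1) ^+ (q - p) * Lambdash a (n%:Z - q%:Z) (q - p) = lambda_mx p q.
Proof.
rewrite leq_eqVlt /lambda_mx /Lambdash => /predU1P[->|pq].
  by rewrite subnn mulmat_diag dcoef0 /fps_neg.
rewrite /mulmat pq -subnSK // dcoef_residue.
rewrite (residue_neg (@malg_scaleAr _ _)) size_map size_iota; congr (_ * _).
rewrite -[RHS]residue_rev -!map_rev; congr residue.
(* The nodes of tau (n - q) (hat a) are the - b_{q-1}, - b_{q-2}, ... : the
   same as for S, negated and in decreasing order. *)
have -> : rev (iota p.+1 (q - p.+1)) = map (subn q) (iota 1 (q - p.+1)).
  apply: (@eq_from_nth _ 0%N); rewrite size_rev size_iota ?size_map ?size_iota //.
  move=> i lt_i; rewrite nth_rev ?size_iota // (nth_map 0%N) ?size_iota //.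
  by rewrite !nth_iota //; lia.
rewrite -!map_comp; apply/eq_in_map => i; rewrite mem_iota => i_bd.
by rewrite /tau /hat /node /=; congr (- a _); lia.
Qed.

Lemma sigma_lambda_mx N p q : (q < N)%N ->
  \sum_(r < N) sigma_mx p r * lambda_mx r q = (p == q)%:R.
Proof.
have [_ _ sl] := LambdaP a; move=> qN.
rewrite (mulmat_mul _ (@malg_scaleAr _ _)) // (eq_mulmat _ sl).
exact: mulmat_one.
Qed.

Lemma lambda_sigma_mx N p q : (q < N)%N ->
  \sum_(r < N) lambda_mx p r * sigma_mx r q = (p == q)%:R.
Proof.
have [_ ls _] := LambdaP a; move=> qN.
rewrite (mulmat_mul _ (@malg_scaleAr _ _)) // (eq_mulmat _ ls).
exact: mulmat_one.
Qed.

Lemma hook_sum k l p e : (e <= k.+1)%N ->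
  (\sum_(nu < k.+1 | p <= nu < e) tnth (hook k l) nu)%N =
    (minn e k - p + (if (p <= k < e)%N then l else 0))%N.
Proof.
move=> ek; pose part nu := if (nu < k)%N then 1%N else l.
have partE (nu : 'I_k.+1) : tnth (hook k l) nu = part nu.
  rewrite (tnth_nth 0%N) /= nth_rcons size_nseq nth_nseq /part.
  by case: ltnP => // k_le; rewrite eqn_leq k_le -ltnS ltn_ord.
rewrite (eq_bigr _ (fun nu _ => partE nu)).
transitivity (\sum_(p <= nu < e) part nu)%N.
  rewrite (big_nat_widen _ _ k.+1) // big_geq_mkord.
  by apply: eq_bigl => nu; rewrite andbC.
have ones m : (m <= k)%N -> (\sum_(p <= nu < m) part nu = m - p)%N.
  move=> mk; rewrite -[RHS]muln1 -sum_nat_const_nat.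
  by rewrite !big_nat; apply: eq_bigr => nu /andP[_ num]; rewrite /part (leq_trans num).
move: ek; rewrite leq_eqVlt ltnS => /predU1P[->|ek]; last first.
  by rewrite ones // (minn_idPl ek) ltnNge ek andbF addn0.
rewrite ltnSn andbT (minn_idPr (leqnSn k)); case: leqP => pk.
  by rewrite big_nat_recr //= ones // /part ltnn.
by rewrite big_geq // addn0; apply/esym/eqP; rewrite subn_eq0 ltnW.
Qed.

(** All shifts in row p add up to n - p - 1, the value for which row p of the
ribbon matrix is part of row p of U. The subdiagonal ones are the diagonal of
U, and the last part n - k moves the last column to column n. *)
Lemma ribbon_mx_hook k : (k < n)%N ->
  ribbon_mx a (hook k (n - k))
      (fun p => (ribbon_shift (hook k (n - k)) p)%:Z + (n%:Z - k%:Z - 1)) =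
    \matrix_(p < k.+1, q < k.+1) sigma_mx p (if (q < k)%N then q.+1 else n).
Proof.
move=> kn; apply/matrixP => p q; rewrite !mxE.
have pk := leq_ord p; have qk := leq_ord q.
have [pq|qp] := leqP p q; last first.
  rewrite (leq_trans qp pk) /sigma_mx.
  have [->|ne_pq] := eqVneq (p : nat) q.+1; first by rewrite mulmat_diag sigma0.
  by rewrite mulmat_lower // ltn_neqAle eq_sym ne_pq.
rewrite /ribbon_shift !hook_sum // ltnn andbF addn0 minnn.
have -> : (k - p)%:Z + (n%:Z - k%:Z - 1) = n%:Z - p%:Z - 1 by lia.
rewrite -Ssh_mulmat; last by case: ifP; lia.
rewrite (eq_bigl (fun nu : 'I_k.+1 => p <= nu < q.+1)%N) // hook_sum // pk /=.
by congr Ssh; case: ltnP; lia.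
Qed.

Lemma ribbon_hook k : (k < n)%N ->
  ribbon a (hook k (n - k)) (n%:Z - k%:Z - 1) =
    (-1) ^+ k * \sum_(q < k.+1) lambda_mx 0 q * sigma_mx q n.
Proof.
move=> kn; rewrite /ribbon /ribbonK (ribbon_mx_hook kn).
rewrite (@quasidet_hessenberg _ _ lambda_mx).
- by [].
- by move=> p q _ qk; rewrite sigma_lambda_mx.
- by move=> p q _ qk; rewrite lambda_sigma_mx.
- case=> [|p]; first by rewrite /sigma_mx mulmat_diag sigma0.
  by rewrite /sigma_mx mulmat_lower.
case=> [|p]; first by rewrite /lambda_mx mulmat_diag lambda0.
by rewrite /lambda_mx mulmat_lower.
Qed.

Lemma LambdaS_mulmat k : (k <= n)%N ->
  (-1) ^+ k * (Lambdash a (n%:Z - k%:Z) k * Ssh a (n%:Z - k%:Z - 1) (n - k)) =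
    lambda_mx 0 k * sigma_mx k n.
Proof.
move=> kn; rewrite -(Ssh_mulmat kn) -(Lambdash_mulmat (leq0n k)) subn0.
exact: mulrA.
Qed.

End SymMulMat.

(** * The two formulas *)

Lemma sum_partial_sums (V : nmodType) (F : nat -> V) n :
  \sum_(k < n) \sum_(q < k.+1) F q = \sum_(q < n) F q *+ (n - q).
Proof.
elim: n => [|n IHn]; first by rewrite !big_ord0.
rewrite big_ord_recr IHn /= [in LHS]big_ord_recr [RHS]big_ord_recr /= subSnn mulr1n.
rewrite addrA -big_split; congr (_ + _); apply: eq_bigr => q _ /=.
by rewrite -mulrSr -subSn // ltnW.
Qed.

(** The weights n - k and k add up to the constant n. *)
Lemma sum_weights_compl (V : zmodType) (F : nat -> V) n :
    \sum_(k < n.+1) F k = 0 ->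
  \sum_(k < n) F k *+ (n - k) = - \sum_(k < n) F k.+1 *+ k.+1.
Proof.
move=> F0; apply/eqP; rewrite -addr_eq0.
have -> : \sum_(k < n) F k.+1 *+ k.+1 = \sum_(k < n.+1) F k *+ k.
  by rewrite big_ord_recl mulr0n add0r.
have -> : \sum_(k < n) F k *+ (n - k) = \sum_(k < n.+1) F k *+ (n - k).
  by rewrite big_ord_recr /= subnn mulr0n addr0.
rewrite -big_split /= (eq_bigr (fun k : 'I_n.+1 => F k *+ n)) => [|k _].
  by rewrite sumrMnl F0 mul0rn.
by rewrite -mulrnDr subnK // -ltnS.
Qed.

Theorem corollary35 (K : fieldType) (charK0 : [pchar K] =i pred0)
    (a : int -> K) (n : nat) (n_ge1 : (1 <= n)%N) :
  Psi a n =
    \sum_(0 <= k < n) (-1) ^+ k * ribbon a (hook k (n - k)) (n%:Z - k%:Z - 1)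
  /\
  Psi a n =
    \sum_(1 <= k < n.+1) (-1) ^+ (k - 1) * k%:R *
      (Lambdash a (n%:Z - k%:Z) k * Ssh a (n%:Z - k%:Z - 1) (n - k)).
Proof.
pose T k := lambda_mx a n 0 k * sigma_mx a n k n.
have PsiE : Psi a n = \sum_(k < n) T k *+ (n - k).
  apply: eq_bigr => k _; rewrite /T -(LambdaS_mulmat _ (ltnW (ltn_ord k))).
  by rewrite mulr_natr mulrnAl.
split.
  rewrite PsiE big_mkord -sum_partial_sums; apply: eq_bigr => k _.
  by rewrite (ribbon_hook a (ltn_ord k)) mulrA -expr2 sqrr_sign mul1r.
have T_sum0 : \sum_(k < n.+1) T k = 0.
  by rewrite lambda_sigma_mx // eq_sym eqn0Ngt n_ge1.
rewrite PsiE (sum_weights_compl T_sum0) big_add1 big_mkord -sumrN.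
apply: eq_bigr => k _; rewrite /T -(LambdaS_mulmat _ (ltn_ord k)) subn1 exprS.
by rewrite mulN1r mulNr mulNrn opprK mulr_natr mulrnAl.
Qed.
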